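(* Let $\mathbf{C}$ be a braided strict monoidal category with tensor $\otimes$, unit $I$ and braiding (twist) $\tau$, and let $(G,\nabla,\Delta,n,e)$ be a commutative Frobenius algebra in $\mathbf{C}$. Put $$\epsilon = e\nabla : G\otimes G\to I,\qquad \eta=\Delta n: I\to G\otimes G .$$ Then $(G,\eta,\epsilon)$ is a tangle algebra in $\mathbf{C}$; that is, $$(\epsilon\otimes 1_G)(1_G\otimes\eta)=1_G=(1_G\otimes\epsilon)(\eta\otimes 1_G),\qquad \epsilon\,\tau_{G,G}=\epsilon,\qquad \tau_{G,G}\,\eta=\eta .$$
   Context: Composition is written right to left ($gf$ means first $f$, then $g$). Braided strict monoidal category: a category $\mathbf{C}$ with a functor $\otimes:\mathbf{C}\times\mathbf{C}\to\mathbf{C}$, strictly associative and strictly unital with unit object $I$ on objects and arrows, and a natural family of isomorphisms $\tau_{A,B}:A\otimes B\to B\otimes A$ such that $\tau_{A,B\otimes C}=(1_B\otimes\tau_{A,C})(\tau_{A,B}\otimes 1_C)$ and $\tau_{A\otimes B,C}=(\tau_{A,C}\otimes 1_B)(1_A\otimes\tau_{B,C})$ for all objects $A,B,C$. Commutative Frobenius algebra in $\mathbf{C}$: an object $G$ with arrows $\nabla:G\otimes G\to G$, $\Delta:G\to G\otimes G$, $n:I\to G$, $e:G\to I$ such that $(G,\nabla,n)$ is a monoid (associative, unital), $(G,\Delta,e)$ is a comonoid (coassociative, counital), and $$(1_G\otimes\nabla)(\Delta\otimes 1_G)=\Delta\nabla=(\nabla\otimes 1_G)(1_G\otimes\Delta),\qquad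 \nabla\tau_{G,G}=\nabla,\qquad \tau_{G,G}\Delta=\Delta .$$ Tangle algebra in $\mathbf{C}$: an object $X$ with arrows $\eta:I\to X\otimes X$ and $\epsilon:X\otimes X\to I$ such that $(\epsilon\otimes 1)(1\otimes\eta)=1=(1\otimes\epsilon)(\eta\otimes 1)$, $\epsilon\tau=\epsilon$ and $\tau\eta=\eta$. *)

(* Defs.v *)
Set Implicit Arguments.
Unset Strict Implicit.

Declare Scope ob_scope.
Declare Scope hom_scope.
Delimit Scope ob_scope with ob.
Delimit Scope hom_scope with hom.

Record category := Category {
  ob :> Type;
  hom : ob -> ob -> Type;
  idm : forall A, hom A A;
  comp : forall A B C, hom B C -> hom A B -> hom A C;
  comp_idl : forall A B (f : hom A B), comp (idm B) f = f;
  comp_idr : forall A B (f : hom A B), comp f (idm A) = f;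
  comp_assoc : forall A B C D (h : hom C D) (g : hom B C) (f : hom A B),
    comp h (comp g f) = comp (comp h g) f
}.

Bind Scope ob_scope with ob.
Bind Scope hom_scope with hom.

Arguments hom {c} A B.
Arguments idm {c} A.
Arguments comp {c A B C} g f.

Notation "g ∘ f" := (comp g f) (at level 40, left associativity) : hom_scope.
Notation "'1_' A" := (idm A) (at level 9, A at level 9, format "1_ A") : hom_scope.

Definition is_iso (C : category) (A B : C) (f : hom A B) : Prop :=
  exists g : hom B A, (g ∘ f = 1_A)%hom /\ (f ∘ g = 1_B)%hom.

(* The identity arrow of A = B, typed as an arrow from A to B.  Equal objects
   need not be convertible, so wherever a composite is well typed only because
   of an equation between objects, such an identity arrow has to be inserted. *)
Definition eqhom (C : category) (A B : C) (e : A = B) : hom A B :=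
  match e in _ = B' return hom A B' with eq_refl => idm A end.

(* The fields tens_... state that the tensor is a functor C x C -> C.  The
   fields strict_... state that associativity and unitality hold on the nose
   for arrows too: f ⊗ (g ⊗ h) and (f ⊗ g) ⊗ h are equal up to the identity
   arrows between their (equal) sources and targets. *)
Record strict_monoidal_category := StrictMonoidalCategory {
  smc_cat :> category;
  unit_ob : smc_cat;
  tens_ob : smc_cat -> smc_cat -> smc_cat;
  tens_hom : forall A A' B B' : smc_cat,
    hom A A' -> hom B B' -> hom (tens_ob A B) (tens_ob A' B');
  tens_id : forall A B : smc_cat,
    tens_hom (idm A) (idm B) = idm (tens_ob A B);
  tens_comp : forall (A A' A'' B B' B'' : smc_cat)
      (f' : hom A' A'') (f : hom A A') (g' : hom B' B'') (g : hom B B'),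
    tens_hom (comp f' f) (comp g' g) = comp (tens_hom f' g') (tens_hom f g);
  ob_assoc : forall A B C : smc_cat,
    tens_ob (tens_ob A B) C = tens_ob A (tens_ob B C);
  ob_unitl : forall A : smc_cat, tens_ob unit_ob A = A;
  ob_unitr : forall A : smc_cat, tens_ob A unit_ob = A;
  strict_assoc : forall (A A' B B' C C' : smc_cat)
      (f : hom A A') (g : hom B B') (h : hom C C'),
    comp (eqhom (ob_assoc A' B' C')) (tens_hom (tens_hom f g) h) =
    comp (tens_hom f (tens_hom g h)) (eqhom (ob_assoc A B C));
  strict_unitl : forall (A A' : smc_cat) (f : hom A A'),
    comp (eqhom (ob_unitl A')) (tens_hom (idm unit_ob) f) =
    comp f (eqhom (ob_unitl A));
  strict_unitr : forall (A A' : smc_cat) (f : hom A A'),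
    comp (eqhom (ob_unitr A')) (tens_hom f (idm unit_ob)) =
    comp f (eqhom (ob_unitr A))
}.

Arguments unit_ob {s}.
Arguments tens_ob {s} A B.
Arguments tens_hom {s A A' B B'} f g.

Notation "A ⊗ B" := (tens_ob A B) (at level 35, right associativity) : ob_scope.
Notation "f ⊗ g" := (tens_hom f g) (at level 35, right associativity) : hom_scope.
Notation "'I'" := unit_ob : ob_scope.

Section StructuralIdentities.
Variable M : strict_monoidal_category.
Implicit Types A B C : M.

Definition assoc A B C : hom ((A ⊗ B) ⊗ C) (A ⊗ (B ⊗ C)) :=
  eqhom (ob_assoc A B C).
Definition assoc_inv A B C : hom (A ⊗ (B ⊗ C)) ((A ⊗ B) ⊗ C) :=
  eqhom (eq_sym (ob_assoc A B C)).
Definition unitl A : hom (I ⊗ A) A := eqhom (ob_unitl A).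
Definition unitl_inv A : hom A (I ⊗ A) := eqhom (eq_sym (ob_unitl A)).
Definition unitr A : hom (A ⊗ I) A := eqhom (ob_unitr A).
Definition unitr_inv A : hom A (A ⊗ I) := eqhom (eq_sym (ob_unitr A)).

End StructuralIdentities.

(* Without the identity arrows assoc and assoc_inv, the two hexagon laws read
   τ_{A,B⊗C} = (1_B ⊗ τ_{A,C})(τ_{A,B} ⊗ 1_C) and
   τ_{A⊗B,C} = (τ_{A,C} ⊗ 1_B)(1_A ⊗ τ_{B,C}). *)
Record braided_strict_monoidal_category := BraidedStrictMonoidalCategory {
  bmc_smc :> strict_monoidal_category;
  braid : forall A B : bmc_smc, hom (A ⊗ B) (B ⊗ A);
  braid_iso : forall A B : bmc_smc, is_iso (braid A B);
  braid_natural : forall (A A' B B' : bmc_smc) (f : hom A A') (g : hom B B'),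
    (braid A' B' ∘ (f ⊗ g) = (g ⊗ f) ∘ braid A B)%hom;
  braid_tensr : forall A B C : bmc_smc,
    (braid A (B ⊗ C) =
       assoc_inv B C A ∘ (1_B ⊗ braid A C) ∘ assoc B A C ∘
       (braid A B ⊗ 1_C) ∘ assoc_inv A B C)%hom;
  braid_tensl : forall A B C : bmc_smc,
    (braid (A ⊗ B) C =
       assoc C A B ∘ (braid A C ⊗ 1_B) ∘ assoc_inv A C B ∘
       (1_A ⊗ braid B C) ∘ assoc A B C)%hom
}.

Arguments braid {b} A B.

Section Algebras.
Variable M : braided_strict_monoidal_category.
Variable G : M.
Local Open Scope hom_scope.

Record is_monoid (mu : hom (G ⊗ G) G) (n : hom I G) : Prop := IsMonoid {
  mul_assoc : mu ∘ (mu ⊗ 1_G) = mu ∘ (1_G ⊗ mu) ∘ assoc G G G;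
  mul_unitl : mu ∘ (n ⊗ 1_G) ∘ unitl_inv G = 1_G;
  mul_unitr : mu ∘ (1_G ⊗ n) ∘ unitr_inv G = 1_G
}.

Record is_comonoid (delta : hom G (G ⊗ G)) (e : hom G I) : Prop := IsComonoid {
  comul_assoc : assoc G G G ∘ (delta ⊗ 1_G) ∘ delta = (1_G ⊗ delta) ∘ delta;
  comul_unitl : unitl G ∘ (e ⊗ 1_G) ∘ delta = 1_G;
  comul_unitr : unitr G ∘ (1_G ⊗ e) ∘ delta = 1_G
}.

Record is_comm_frobenius_algebra
    (mu : hom (G ⊗ G) G) (delta : hom G (G ⊗ G))
    (n : hom I G) (e : hom G I) : Prop := IsCommFrobeniusAlgebra {
  frob_monoid : is_monoid mu n;
  frob_comonoid : is_comonoid delta e;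
  frob_l : (1_G ⊗ mu) ∘ assoc G G G ∘ (delta ⊗ 1_G) = delta ∘ mu;
  frob_r : delta ∘ mu = (mu ⊗ 1_G) ∘ assoc_inv G G G ∘ (1_G ⊗ delta);
  frob_mul_comm : mu ∘ braid G G = mu;
  frob_comul_comm : braid G G ∘ delta = delta
}.

Record is_tangle_algebra (eta : hom I (G ⊗ G)) (epsilon : hom (G ⊗ G) I) : Prop :=
  IsTangleAlgebra {
  tangle_l : unitl G ∘ (epsilon ⊗ 1_G) ∘ assoc_inv G G G ∘ (1_G ⊗ eta) ∘ unitr_inv G
             = 1_G;
  tangle_r : unitr G ∘ (1_G ⊗ epsilon) ∘ assoc G G G ∘ (eta ⊗ 1_G) ∘ unitl_inv G
             = 1_G;
  tangle_counit_comm : epsilon ∘ braid G G = epsilon;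
  tangle_unit_comm : braid G G ∘ eta = eta
}.

End Algebras.

(* Main.v *)
(* Expanding ε = e∇ and η = Δn, each zigzag contains one side of the Frobenius
   law in its middle; replacing that side by Δ∇ leaves a counit law for Δ
   composed with a unit law for ∇. *)
Require Import Defs.

(** The first zigzag is $(e\otimes 1)(\nabla\otimes 1)(1\otimes\Delta)(1\otimes n)=(e\otimes
    1)\Delta\,\nabla(1\otimes n)=1$, and the second is its mirror image. Symmetry of $\epsilon$ and
    $\eta$ is commutativity of $\nabla$ and $\Delta$. *)

Lemma tens_comp_idr (M : strict_monoidal_category) (A B C D : M)
    (g : hom B C) (f : hom A B) :
  ((g ∘ f) ⊗ 1_D = (g ⊗ 1_D) ∘ (f ⊗ 1_D))%hom.
Proof. now rewrite <- tens_comp, comp_idl. Qed.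

Lemma tens_comp_idl (M : strict_monoidal_category) (A B C D : M)
    (g : hom B C) (f : hom A B) :
  (1_D ⊗ (g ∘ f) = (1_D ⊗ g) ∘ (1_D ⊗ f))%hom.
Proof. now rewrite <- tens_comp, comp_idl. Qed.

Theorem theorem2p1 (C : braided_strict_monoidal_category) (G : C)
    (mu : hom (G ⊗ G) G) (delta : hom G (G ⊗ G)) (n : hom I G) (e : hom G I)
    (HG : is_comm_frobenius_algebra mu delta n e) :
  is_tangle_algebra (delta ∘ n)%hom (e ∘ mu)%hom.
Proof.
destruct HG as [[_ mul_l mul_r] [_ comul_l comul_r] frl frr mulC comulC].
split.
- rewrite tens_comp_idr, tens_comp_idl.
  (* This bracketing exposes a side of [frr]; after [comul_l] cancels, what remains is exactly
     [mul_r]. *)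
  transitivity (unitl G ∘ (e ⊗ 1_G) ∘
    ((mu ⊗ 1_G) ∘ assoc_inv G G G ∘ (1_G ⊗ delta)) ∘
    (1_G ⊗ n) ∘ unitr_inv G)%hom.
  { now rewrite !comp_assoc. }
  now rewrite <- frr, !comp_assoc, comul_l, comp_idl.
- rewrite tens_comp_idr, tens_comp_idl.
  (* Here the exposed factor is a side of [frl], and [mul_l] is what remains. *)
  transitivity (unitr G ∘ (1_G ⊗ e) ∘
    ((1_G ⊗ mu) ∘ assoc G G G ∘ (delta ⊗ 1_G)) ∘
    (n ⊗ 1_G) ∘ unitl_inv G)%hom.
  { now rewrite !comp_assoc. }
  now rewrite frl, !comp_assoc, comul_r, comp_idl.
- now rewrite <- comp_assoc, mulC.
- now rewrite comp_assoc, comulC.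
Qed.
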